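(* Let $K:\mathbb{B}^n\times\mathbb{B}^n\to\mathbb{R}$ be a reproducing kernel. For any $R\in SO(n)$, the X-ray transform $\mathcal{P}_R:\mathbb{H}(K)\to\mathbb{H}(\tilde K^R)$ is a contractive, surjective, linear map. Its adjoint operator $\mathcal{P}_R^*:\mathbb{H}(\tilde K^R)\to\mathbb{H}(K)$ is an isometry, uniquely determined by $$\mathcal{P}_R^*(\tilde k^R_{\mathbf{x}})=\int_{I_{\|\mathbf{x}\|}}k_{R^\top[\mathbf{x}:z]}\,dz,\qquad \mathbf{x}\in\mathbb{B}^{n-1},$$ in the sense of Bochner integration, or equivalently, for any $\mathbf{x}\in\mathbb{B}^{n-1}$, $\mathbf{z}\in\mathbb{B}^n$, $$\mathcal{P}_R^*(\tilde k^R_{\mathbf{x}})(\mathbf{z})=\langle \mathcal{P}_R^*(\tilde k^R_{\mathbf{x}}),k_{\mathbf{z}}\rangle_{\mathbb{H}(K)}=\int_{I_{\|\mathbf{x}\|}}K(\mathbf{z},R^\top[\mathbf{x}:z])\,dz=\mathcal{P}_Rk_{\mathbf{z}}(\mathbf{x}).$$ Let $\mathbb{H}_R(K):=\mathcal{R}(\mathcal{P}_R^* )$ be the range of the adjoint operator and $\mathcal{N}(\mathcal{P}_R)$ the null space of $\mathcal{P}_R$. Then: (1) $\mathcal{P}_R\circ\mathcal{P}_R^*:\mathbb{H}(\tilde K^R)\to\mathbb{H}(\tilde K^R)$ is the identity. (2) $\mathbb{H}_R(K)=(\mathcal{N}(\mathcal{P}_R))^\perp$ and $(\mathbb{H}_R(K))^\perp=\mathcal{N}(\mathcal{P}_R)$.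 (3) Any $f\in\mathbb{H}(K)$ can be uniquely expressed as a direct sum $f=(\mathcal{P}_R^*\circ\mathcal{P}_R)f\oplus(f-(\mathcal{P}_R^*\circ\mathcal{P}_R)f)\in\mathbb{H}_R(K)\oplus\mathcal{N}(\mathcal{P}_R)$; thus $f\in\mathbb{H}_R(K)$ if and only if $f=(\mathcal{P}_R^*\circ\mathcal{P}_R)f$. (4) For $g\in\mathbb{H}(\tilde K^R)$, we have $$\{f\in\mathbb{H}(K):g=\mathcal{P}_Rf\}=\mathcal{P}_R^*g\oplus\mathcal{N}(\mathcal{P}_R),\qquad \|g\|_{\mathbb{H}(\tilde K^R)}=\|\mathcal{P}_R^*g\|_{\mathbb{H}(K)}=\min\{\|f\|_{\mathbb{H}(K)}:g=\mathcal{P}_Rf\}.$$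
   Context: Throughout $n\ge2$. $\mathbb{B}^m$ is the closed unit ball of $\mathbb{R}^m$; $[\mathbf{x}:z]\in\mathbb{R}^n$ denotes the concatenation of $\mathbf{x}\in\mathbb{R}^{n-1}$ and $z\in\mathbb{R}$; for $\mathbf{x}\in\mathbb{B}^{n-1}$, $I_{\|\mathbf{x}\|}:=[-\sqrt{1-\|\mathbf{x}\|^2},\sqrt{1-\|\mathbf{x}\|^2}]$. A (reproducing) kernel on a set $E$ is a symmetric positive semidefinite function $K:E\times E\to\mathbb{R}$; $\mathbb{H}(K)$ is the associated reproducing kernel Hilbert space (RKHS) of real functions on $E$, with generators $k_{\mathbf{z}}:=K(\cdot,\mathbf{z})$ and reproducing property $f(\mathbf{z})=\langle f,k_{\mathbf{z}}\rangle_{\mathbb{H}(K)}$. For $R\in SO(n)$ the X-ray transform at orientation $R$ of $f:\mathbb{B}^n\to\mathbb{R}$ is $\mathcal{P}_Rf(\mathbf{x})=\int_{I_{\|\mathbf{x}\|}}f(R^\top[\mathbf{x}:z])\,dz$, $\mathbf{x}\in\mathbb{B}^{n-1}$. The induced kernel $\tilde K^R:\mathbb{B}^{n-1}\times\mathbb{B}^{n-1}\to\mathbb{R}$ is $$\tilde K^R(\mathbf{x}_1,\mathbf{x}_2):=\int_{I_{\|\mathbf{x}_2\|}}\int_{I_{\|\mathbf{x}_1\|}}K(R^\top[\mathbf{x}_1:z_1],R^\top[\mathbf{x}_2:z_2])\,dz_1\,dz_2,$$ which is a kernel on $\mathbb{B}^{n-1}$, with generators $\tilde k^R_{\mathbf{x}}:=\tilde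 K^R(\cdot,\mathbf{x})$. It is a standing convention that these integrals exist for all arguments (automatic when $K$ is continuous).
   Formalization: The Bochner formula for the adjoint on a generator is stated for those x where z ↦ k_{R^T[x:z]} is Bochner integrable on the chord; for K(z,w)=1_{z=w} this integral does not exist, though all scalar integrals do. *)

(* Defs.v *)
From HB Require Import structures.
From mathcomp Require Import all_boot all_order all_algebra.
From mathcomp Require Import all_classical all_reals all_analysis.

Set Implicit Arguments.
Unset Strict Implicit.
Unset Printing Implicit Defensive.

Import Order.TTheory GRing.Theory Num.Theory.
Import numFieldNormedType.Exports.

Local Open Scope classical_set_scope.
Local Open Scope ring_scope.

Definition is_kernel (R : realType) (E : Type) (K : E -> E -> R) : Prop :=
  (forall x y, K x y = K y x) /\
  (forall (p : nat) (x : 'I_p -> E) (c : 'I_p -> R),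
      0 <= \sum_(i < p) \sum_(j < p) c i * c j * K (x i) (x j)).

(** A realization of the RKHS of [K]: a real Hilbert space (a complete normed
    space whose norm comes from an inner product) whose elements are, through
    the injective linear map [ev], functions on [E], and which contains the
    generators [k_z = K(., z)], with the reproducing property.  By the
    Moore-Aronszajn theorem every kernel has one, and it is unique up to a
    unitary map commuting with [ev] and [gen]. *)
Record rkhs (R : realType) (E : Type) (K : E -> E -> R) := RKHS {
  rkhs_space :> completeNormedModType R ;
  ip : {dot rkhs_space for idfun} ;
  normE : forall f : rkhs_space, `|f| = Num.sqrt (ip f f) ;
  ev : {linear rkhs_space -> (E -> R^o)} ;
  ev_inj : injective ev ;
  gen : E -> rkhs_space ;
  ev_gen : forall z w : E, ev (gen z) w = K w z ;
  reproducing : forall (f : rkhs_space) (z : E), ev f z = ip f (gen z)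
}.

Arguments ip {R E K r}.
Arguments ev {R E K r}.
Arguments gen {R E K r}.

Definition orthogonal_compl (R : realType) (E : Type) (K : E -> E -> R)
    (H : rkhs K) (A : set H) : set H :=
  [set f | forall g, A g -> ip f g = 0].

Definition null_space (R : realType) (U V : lmodType R) (P : U -> V) : set U :=
  [set f | P f = 0].

Definition is_adjoint (R : realType) (E E' : Type) (K : E -> E -> R)
    (K' : E' -> E' -> R) (H : rkhs K) (H' : rkhs K')
    (P : H -> H') (Pa : H' -> H) : Prop :=
  forall (f : H) (g : H'), ip (P f) g = ip f (Pa g).

Section Bochner.
Context (d : measure_display) (T : measurableType d) (R : realType).
Context (mu : {measure set T -> \bar R}) (V : completeNormedModType R).
Implicit Types (D : set T) (s f : T -> V).

Definition bochner_simple D s : Prop :=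
  [/\ finite_set (range s),
      forall v, measurable (s @^-1` [set v]) &
      forall v, v != 0 -> (mu (D `&` s @^-1` [set v]) < +oo)%E].

Definition bochner_simple_integral D s : V :=
  \sum_(v \in range s) fine (mu (D `&` s @^-1` [set v])) *: v.

Definition bochner_approx D f (s : nat -> T -> V) : Prop :=
  [/\ forall n, bochner_simple D (s n),
      forall n, mu.-integrable D (fun x => `|f x - s n x|%:E) &
      \int[mu]_(x in D) `|f x - s n x| @[n --> \oo] --> (0 : R)].

Definition bochner_integrable D f : Prop :=
  exists s : nat -> T -> V, bochner_approx D f s.

(** The limit does not depend on the approximating sequence; [0] is a junk
    value for functions that are not Bochner integrable. *)
Definition bochner_integral D f : V :=
  xget 0 [set v | exists2 s : nat -> T -> V,
    bochner_approx D f s &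
    bochner_simple_integral D (s n) @[n --> \oo] --> v].

End Bochner.

Section XRay.
Context (R : realType).

(** The library's norm on matrices is the sup norm, hence this definition. *)
Definition enorm (n : nat) (x : 'cV[R]_n) : R :=
  Num.sqrt (\sum_(i < n) x i ord0 ^+ 2).

Definition uball (n : nat) : Type := {x : 'cV[R]_n | enorm x <= 1}.

Fact enorm0_le1 (n : nat) : enorm (0 : 'cV[R]_n) <= 1.
Proof.
by rewrite /enorm big1 ?sqrtr0 // => i _; rewrite mxE expr0n.
Qed.

Definition uball0 (n : nat) : uball n := exist _ 0 (enorm0_le1 n).

Definition SO (n : nat) : set 'M[R]_n :=
  [set Q | Q *m Q^T = 1%:M /\ \det Q = 1].

Context (m : nat).
Implicit Types (x : uball m) (Q : 'M[R]_(m + 1)).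

Definition chord x : set R :=
  `[- Num.sqrt (1 - enorm (val x) ^+ 2), Num.sqrt (1 - enorm (val x) ^+ 2)]%classic.

(** The point [Q^T [x : z]] of the unit ball; the default value [uball0] is
    never used when [z] is in [chord x] and [Q] is orthogonal. *)
Definition ray Q x (z : R) : uball (m + 1) :=
  insubd (uball0 (m + 1)) (Q^T *m col_mx (val x) (z%:M : 'cV[R]_1)).

Definition xray Q (f : uball (m + 1) -> R) : uball m -> R :=
  fun x => \int[lebesgue_measure]_(z in chord x) f (ray Q x z).

Definition xray_exists Q (f : uball (m + 1) -> R) : Prop :=
  forall x, lebesgue_measure.-integrable (chord x)
    (fun z => (f (ray Q x z))%:E).

Definition induced_kernel Q (K : uball (m + 1) -> uball (m + 1) -> R) :
    uball m -> uball m -> R :=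
  fun x1 x2 => \int[lebesgue_measure]_(z2 in chord x2)
    \int[lebesgue_measure]_(z1 in chord x1) K (ray Q x1 z1) (ray Q x2 z2).

Definition induced_kernel_exists Q
    (K : uball (m + 1) -> uball (m + 1) -> R) : Prop :=
  forall x1 x2,
    (forall z2, chord x2 z2 -> lebesgue_measure.-integrable (chord x1)
       (fun z1 => (K (ray Q x1 z1) (ray Q x2 z2))%:E)) /\
    lebesgue_measure.-integrable (chord x2)
      (fun z2 => (\int[lebesgue_measure]_(z1 in chord x1)
                    K (ray Q x1 z1) (ray Q x2 z2))%:E).

Fact enorm_sqr (n : nat) (x : 'cV[R]_n) :
  enorm x ^+ 2 = \sum_(i < n) x i ord0 ^+ 2.
Proof. by rewrite sqr_sqrtr// sumr_ge0// => i _; rewrite sqr_ge0. Qed.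

Fact val_ray Q x (z : R) : SO Q -> chord x z ->
  val (ray Q x z) = Q^T *m col_mx (val x) (z%:M : 'cV[R]_1).
Proof.
move=> [QQ _] zx; rewrite /ray val_insubd ifT//.
rewrite -[leRHS]sqrtr1 ler_wsqrtr//.
set y := col_mx _ _.
have nE (w : 'cV[R]_(m + 1)) :
  \sum_(i < m + 1) w i ord0 ^+ 2 = (w^T *m w) ord0 ord0.
  by rewrite mxE; apply: eq_bigr => i _; rewrite mxE expr2.
rewrite nE trmx_mul trmxK mulmxA -(mulmxA y^T) QQ mulmx1 -nE.
rewrite big_split_ord/= big_ord1.
under eq_bigr do rewrite col_mxEu.
rewrite col_mxEd mxE eqxx mulr1n -enorm_sqr.
have x1 : 0 <= 1 - enorm (val x) ^+ 2.
  by rewrite subr_ge0 expr_le1 ?sqrtr_ge0//; exact: (valP x).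
move: zx; rewrite /chord /= in_itv /= -ler_norml => zx.
rewrite -lerBrDl -(sqr_sqrtr x1) -real_normK ?num_real//.
by rewrite lerXn2r ?nnegrE ?sqrtr_ge0.
Qed.

End XRay.

(* Main.v *)
Require Import Defs.
From HB Require Import structures.
From mathcomp Require Import all_boot all_order all_algebra.
From mathcomp Require Import all_classical all_reals all_analysis.
From mathcomp Require Import measurable_realfun ring lra.

Set Implicit Arguments.
Unset Strict Implicit.
Unset Printing Implicit Defensive.

Import Order.TTheory GRing.Theory Num.Theory.
Import numFieldNormedType.Exports.

Local Open Scope classical_set_scope.
Local Open Scope ring_scope.

(** For a point [x] of the smaller ball, let [L_x f] be the integral of [f] over
    the chord attached to [x], that is, the value of the transform at [x].

    The decisive fact is that [L_x], which is only assumed to be defined on all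
    of the RKHS [H], is bounded ([xray_representer]).  The seminorm sending [f]
    to the integral of its absolute value along the chord is finite on [H];
    convergence in an RKHS is pointwise, so Fatou's lemma makes the seminorm lower semicontinuous, and
    Baire's theorem then makes it bounded ([L1_seminorm_bounded]).  By the Riesz
    theorem [L_x f] is the inner product of [f] with some [eta x] in [H].

    Evaluating [eta x] at the points of a second chord gives
    [ip (eta x) (eta y) = induced_kernel Q K x y] ([induced_kernel_gram]).  So
    the induced kernel is a Gram kernel with feature map [eta], and everything
    else is Hilbert space geometry.  The vectors [eta x] and the generators
    [gen x] of the RKHS of the induced kernel have equal Gram matrices, so the
    values of an inner product against the former are realized, with no increase
    of norm, by inner products against the latter ([gram_transfer]).  This
    yields [P], with [ip (P f) (gen x) = ip f (eta x)], and Riesz yields its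
    adjoint [Pa], with [Pa (gen x) = eta x].  Hence [P \o Pa] fixes every
    generator; as it is self-adjoint, and as a vector is determined by its inner
    products with the generators, [P \o Pa] is the identity
    ([feature_operator]).  The range and null space assertions are those of any
    coisometry.

    The Bochner formula for [Pa (gen x)] holds because [eta x] is the weak
    integral of the generators along the chord, and in a Hilbert space a Bochner
    integral is determined by its inner products ([bochner_integral_weak]). *)

(** * Hilbert spaces and the Riesz theorem *)

Section Hilbert.
Context (R : realType) (V : completeNormedModType R).
Context (b : {dot V for idfun}).
Hypothesis normE : forall f : V, `|f| = Num.sqrt (b f f).

Lemma dotC f g : b f g = b g f.
Proof. by rewrite (hermC b) expr0 mul1r. Qed.

Lemma dotDr f g h : b f (g + h) = b f g + b f h.
Proof. exact: linearDr. Qed.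
Lemma dotZr c f g : b f (c *: g) = c * b f g.
Proof. exact: linearZr_LR. Qed.
Lemma dotDl f g h : b (f + g) h = b f h + b g h.
Proof. exact: linearDl. Qed.
Lemma dotZl c f g : b (c *: f) g = c * b f g.
Proof. exact: linearZl_LR. Qed.
Lemma dotBl f g h : b (f - g) h = b f h - b g h.
Proof. exact: linearBl. Qed.
Lemma dotBr f g h : b h (f - g) = b h f - b h g.
Proof. exact: linearBr. Qed.
Lemma dot0l f : b 0 f = 0. Proof. exact: linear0l. Qed.
Lemma dot0r f : b f 0 = 0. Proof. exact: linear0r. Qed.

Lemma dot_ge0 f : 0 <= b f f.
Proof.
have [->|f0] := eqVneq f 0; first by rewrite dot0r.
by apply: ltW; apply: neq0_dnorm_gt0.
Qed.

Lemma dot_norm f : b f f = `|f| ^+ 2.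
Proof. by rewrite normE sqr_sqrtr// dot_ge0. Qed.

Lemma dot_eq0 f : b f f = 0 -> f = 0.
Proof. by rewrite dot_norm => /eqP; rewrite sqrf_eq0 normr_eq0 => /eqP. Qed.

Lemma dot_sepl f g : (forall h, b f h = b g h) -> f = g.
Proof.
move=> fg; apply/eqP; rewrite -subr_eq0; apply/eqP/dot_eq0.
by rewrite dotBl fg subrr.
Qed.

Lemma cauchy_schwarz f g : `|b f g| <= `|f| * `|g|.
Proof.
have [->|g0] := eqVneq g 0; first by rewrite dot0r normr0 normr0 mulr0.
have g2 : 0 < b g g by apply: neq0_dnorm_gt0.
have := dot_ge0 (f - (b f g / b g g) *: g).
rewrite dotBr dotZr !dotBl !dotZl (dotC g f) => h.
have {h} : (b f g) ^+ 2 <= b f f * b g g.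
  suff : 0 <= (b f f - b f g ^+ 2 / b g g) * b g g.
    by rewrite mulrBl divfK ?gt_eqF// subr_ge0.
  rewrite mulr_ge0 ?(ltW g2)//; suff <- : b f f - b f g / b g g * b f g -
    b f g / b g g * (b f g - b f g / b g g * b g g) =
    b f f - b f g ^+ 2 / b g g by [].
  by field; rewrite gt_eqF.
rewrite !dot_norm -exprMn -(real_normK (num_real (b f g))).
by rewrite ler_pXn2r// nnegrE ?mulr_ge0.
Qed.

Lemma dot_cvgl (u : nat -> V) f g : u n @[n --> \oo] --> f ->
  b (u n) g @[n --> \oo] --> b f g.
Proof.
move=> uf; apply/cvgrPdist_le => e e0.
have e0' : 0 < e / (`|g| + 1) by rewrite divr_gt0// ltr_wpDl.
move/cvgrPdist_le : uf => /(_ _ e0'); apply: filterS => n.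
move=> h; rewrite -dotBl (le_trans (cauchy_schwarz _ _))//.
have g1 : 0 < `|g| + 1 by rewrite ltr_wpDl.
rewrite ler_pdivlMr// in h; apply: le_trans h.
by rewrite ler_wpM2l// lerDl.
Qed.

(** The relation [S] is the graph of a bounded linear functional defined on some
    linear subspace.  Working with a graph lets the same proof serve functionals
    on the whole space and functionals given on spanning families, whose
    coefficients are not unique.  The representing vector is found as the
    minimizer of [`|w| ^+ 2 - 2 * a] over the graph, which is bounded below by
    [- C ^+ 2]. *)
Lemma riesz_subspace (S : V -> R -> Prop) (C : R) : 0 <= C ->
  S 0 0 ->
  (forall w a w' a' c, S w a -> S w' a' -> S (w + c *: w') (a + c * a')) ->
  (forall w a, S w a -> `|a| <= C * `|w|) ->
  exists2 g, (forall w a, S w a -> b g w = a) & `|g| <= C.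
Proof.
move=> C0 S0 Slin Sbnd.
pose E : set R := [set e | exists w a, S w a /\ e = `|w| ^+ 2 - 2 * a].
pose m := inf E.
have Einf : has_inf E.
  split; first by exists 0, 0, 0; split => //; rewrite normr0 mulr0 subr0 expr0n.
  exists (- C ^+ 2) => _ [w [a [wa ->]]].
  have := Sbnd _ _ wa; have := ler_norm a; have := sqr_ge0 (`|w| - C).
  by nra.
have m_le w a : S w a -> m <= `|w| ^+ 2 - 2 * a.
  by move=> wa; apply: ge_inf; [case: Einf|exists w, a].
have /choice[u ua] : forall n, exists u : V * R, S u.1 u.2 /\
    `|u.1| ^+ 2 - 2 * u.2 < m + n.+1%:R^-1.
  move=> n.
  have n0 : 0 < (n.+1%:R^-1 : R) by rewrite invr_gt0.
  have [_ [w [a [wa ->]]] h] := inf_adherent n0 Einf.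
  by exists (w, a).
have parallelogram (w w' : V) : `|w - w'| ^+ 2 =
    2 * `|w| ^+ 2 + 2 * `|w'| ^+ 2 - `|w + w'| ^+ 2.
  by rewrite -!dot_norm !(dotBl, dotBr, dotDl, dotDr) (dotC w' w); ring.
(* [m] is a lower bound along the line [w + t w'], which limits the failure of
   [w] to represent the functional at [w']. *)
have first_order w a w' a' : S w a -> S w' a' ->
    (b w w' - a') ^+ 2 <= (`|w| ^+ 2 - 2 * a - m) * `|w'| ^+ 2.
  move=> wa wa'; have [w'0|w'0] := eqVneq w' 0.
    have := Sbnd _ _ wa'; rewrite w'0 dot0r normr0 mulr0 normr_le0 => /eqP ->.
    by rewrite subrr !expr0n mulr0.
  have q0 : 0 < `|w'| ^+ 2 by rewrite exprn_gt0// normr_gt0.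
  (* The minimizer of the quadratic polynomial in [t]. *)
  pose t := - (b w w' - a') / `|w'| ^+ 2.
  have := m_le _ _ (Slin _ _ _ _ t wa wa').
  rewrite -dot_norm dotDl !dotDr !dotZl !dotZr (dotC w' w) !dot_norm => h.
  rewrite -ler_pdivrMr// lerBrDl -lerBrDr; apply: le_trans h _.
  rewrite le_eqVlt; apply/orP; left; apply/eqP.
  by rewrite /t; field; rewrite normr_eq0.
(* The midpoint of two terms is in the subspace, so the parallelogram law turns
   closeness to the infimum into closeness of the two terms. *)
have u_dist i j : `|(u i).1 - (u j).1| ^+ 2 <= 2 * i.+1%:R^-1 + 2 * j.+1%:R^-1.
  have [ui mi] := ua i; have [uj mj] := ua j.
  have := m_le _ _ (Slin _ _ _ _ (2^-1) (Slin _ _ _ _ (2^-1) S0 ui) uj).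
  rewrite !add0r -scalerDr normrZ exprMn parallelogram.
  rewrite gtr0_norm ?invr_gt0//; move: mi mj.
  by move: (i.+1%:R^-1) (j.+1%:R^-1) => p q; lra.
have u_cvg : cvgn (fun n => (u n).1).
  apply/cauchy_cvgP/cauchy_ballP => e e0.
  have e4 : 0 < e ^+ 2 / 4 by rewrite divr_gt0// exprn_gt0.
  rewrite near_map2; near=> i j; rewrite -ball_normE /=.
  rewrite -(@ltr_pXn2r _ 2)// ?nnegrE ?(ltW e0)//.
  apply: le_lt_trans (u_dist i j) _.
  have : i.+1%:R^-1 < e ^+ 2 / 4.
    by near: i; exact: near_infty_natSinv_lt (PosNum e4).
  have : j.+1%:R^-1 < e ^+ 2 / 4.
    by near: j; exact: near_infty_natSinv_lt (PosNum e4).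
  by move: (i.+1%:R^-1) (j.+1%:R^-1) => p q; lra.
pose g := limn (fun n => (u n).1).
have gu w a : S w a -> b g w = a.
  move=> wa; apply/eqP; rewrite -subr_eq0 -sqrf_eq0 eq_le sqr_ge0 andbT.
  have h1 : (b (u n).1 w - a) ^+ 2 @[n --> \oo] --> (b g w - a) ^+ 2.
    apply: (@cvg_comp _ _ _ _ (fun x : R => x ^+ 2)); last exact: exprn_continuous.
    by apply: cvgB; [exact: dot_cvgl|exact: cvg_cst].
  have h2 : n.+1%:R^-1 * `|w| ^+ 2 @[n --> \oo] --> 0 * `|w| ^+ 2.
    by apply: cvgM; [exact: cvg_harmonic|exact: cvg_cst].
  rewrite mul0r in h2; apply: ler_cvg_to h1 h2 _.
  apply: nearW => n; have [un mn] := ua n.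
  apply: le_trans (first_order _ _ _ _ un wa) _.
  by rewrite ler_wpM2r ?sqr_ge0// lerBlDl ltW.
exists g => //.
have [->|g0] := eqVneq g 0; first by rewrite normr0.
have h1 : b (u n).1 g @[n --> \oo] --> b g g by exact: dot_cvgl.
have h2 : C * `|(u n).1| @[n --> \oo] --> C * `|g|.
  by apply: cvgM; [exact: cvg_cst|exact: cvg_norm].
have : b g g <= C * `|g|.
  apply: ler_cvg_to h1 h2 _; apply: nearW => n.
  have [un _] := ua n; rewrite dotC (gu _ _ un).
  by apply: le_trans (Sbnd _ _ un); exact: ler_norm.
by rewrite dot_norm expr2 ler_pM2r// normr_gt0.
Unshelve. all: end_near. Qed.

Lemma riesz_representation (phi : V -> R) (C : R) : 0 <= C ->
  (forall c f g, phi (f + c *: g) = phi f + c * phi g) ->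
  (forall f, `|phi f| <= C * `|f|) ->
  exists g, forall f, b f g = phi f.
Proof.
move=> C0 philin phiC.
have phi0 : phi 0 = 0.
  by apply/eqP; rewrite -normr_le0 (le_trans (phiC 0))// normr0 mulr0.
have [|w a w' a' c <- <-|w a <-|g gphi _] :=
  @riesz_subspace (fun w a => phi w = a) C C0.
- exact: phi0.
- exact: philin.
- exact: phiC.
by exists g => f; rewrite dotC; exact: gphi.
Qed.

Lemma dot_suml (I : Type) (l : seq I) (c : I -> R) (v : I -> V) g :
  b (\sum_(i <- l) c i *: v i) g = \sum_(i <- l) c i * b (v i) g.
Proof.
elim: l => [|i l IHl]; first by rewrite !big_nil dot0l.
by rewrite !big_cons dotDl dotZl IHl.
Qed.

(** * Bochner integrals in a Hilbert space *)

Section Bochner.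
Context (d : measure_display) (T : measurableType d).
Context (mu : {measure set T -> \bar R}) (D : set T).
Hypothesis mD : measurable D.

Lemma bochner_simple_integral_weak (s : T -> V) : bochner_simple mu D s ->
  forall g, mu.-integrable D (fun t => (b (s t) g)%:E) /\
    \int[mu]_(t in D) b (s t) g = b (bochner_simple_integral mu D s) g.
Proof.
move=> [fs ms mus] g.
pose A v := s @^-1` [set v].
have mA v : measurable (A v) := ms v.
(* The value 0 may be taken on a set of infinite measure, but then the
   integrand vanishes and [fine] returns a number that is multiplied by 0. *)
have intA v : mu.-integrable D (EFin \o (fun t => b v g * \1_(A v) t)) /\
    \int[mu]_(t in D) (b v g * \1_(A v) t) = fine (mu (D `&` A v)) * b v g.
  have [->|v0] := eqVneq v 0.
    rewrite dot0l mulr0.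
    have -> : (fun t => 0 * \1_(A 0) t) = cst 0 :> (T -> R).
      by apply/funext => t; rewrite mul0r.
    by split; [exact: integrable0|rewrite /Rintegral integral0].
  have iA : mu.-integrable D (EFin \o \1_(A v)).
    apply/integrableP; split.
      by apply/measurable_EFinP; exact: (measurable_indic (mA v)).
    rewrite (eq_integral (fun t => (\1_(A v) t)%:E)); last first.
      by move=> t _; rewrite gee0_abs// lee_fin.
    by rewrite integral_indic// setIC mus.
  split; first exact: (integrableZl mD (b v g) iA).
  by rewrite RintegralZl// /Rintegral integral_indic// setIC mulrC.
pose r := finmap.enum_fset (fset_set (range s)).
have sE : (fun t => b (s t) g) = (fun t => \sum_(v <- r) b v g * \1_(A v) t).
  apply/funext => t; rewrite (bigD1_seq (s t)) ?finmap.fset_uniq//=; last first.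
    by rewrite in_fset_set// inE; exists t.
  rewrite indicE mem_set// mulr1 big1 ?addr0// => v vs.
  rewrite indicE memNset ?mulr0// => sv.
  by rewrite /A /= in sv; rewrite sv eqxx in vs.
have sumA (l : seq V) :
    mu.-integrable D (EFin \o (fun t => \sum_(v <- l) b v g * \1_(A v) t)) /\
    \int[mu]_(t in D) (\sum_(v <- l) b v g * \1_(A v) t) =
    b (\sum_(v <- l) fine (mu (D `&` A v)) *: v) g.
  elim: l => [|v l [il IHl]].
    rewrite big_nil dot0l.
    have -> : (fun t => \sum_(v <- [::]) b v g * \1_(A v) t) = cst 0.
      by apply/funext => t; rewrite big_nil.
    by split; [exact: integrable0|rewrite /Rintegral integral0].
  have [iv Iv] := intA v.
  rewrite big_cons dotDl dotZl -Iv -IHl -RintegralD//.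
  have -> : (fun t => \sum_(v <- v :: l) b v g * \1_(A v) t) =
      (fun t => b v g * \1_(A v) t + \sum_(v <- l) b v g * \1_(A v) t).
    by apply/funext => t; rewrite big_cons.
  by split => //; exact: (integrableD mD iv il).
have [ir Ir] := sumA r.
rewrite /bochner_simple_integral fsbig_finite// -Ir.
by rewrite -[X in _.-integrable _ X]/(EFin \o (fun t => b (s t) g)) sE.
Qed.

(** If [eta] is the weak integral of [f], then for simple [s] the difference of
    [eta] and the integral of [s], tested against itself, is the integral of an
    inner product with [f - s]; Cauchy-Schwarz bounds its norm by the integral
    of [`|f - s|].  Thus every approximating sequence has the limit [eta]. *)
Lemma bochner_integral_weak (f : T -> V) (eta : V) :
  (forall g, mu.-integrable D (fun t => (b (f t) g)%:E)) ->
  (forall g, \int[mu]_(t in D) b (f t) g = b eta g) ->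
  bochner_integrable mu D f -> bochner_integral mu D f = eta.
Proof.
move=> fint fI [s0 s0f].
have lims s : bochner_approx mu D f s ->
    bochner_simple_integral mu D (s n) @[n --> \oo] --> eta.
  move=> [ss sint scvg]; apply/cvgrPdist_le => e e0.
  move/cvgrPdist_le : scvg => /(_ _ e0); apply: filterS => n.
  have p0 : 0 <= \int[mu]_(t in D) `|f t - s n t| by exact: Rintegral_ge0.
  rewrite sub0r normrN (ger0_norm p0); apply: le_trans.
  set I := bochner_simple_integral mu D (s n).
  have [h0|h0] := eqVneq (eta - I) 0; first by rewrite h0 normr0.
  rewrite -(@ler_pM2r _ `|eta - I|) ?normr_gt0// -expr2 -dot_norm.
  have [si sI] := bochner_simple_integral_weak (ss n) (eta - I).
  rewrite {1}dotBl -sI -fI -RintegralB//; last exact: fint.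
  rewrite [leRHS]mulrC -RintegralZl//; last exact: sint.
  apply: le_Rintegral => //.
  - exact: (integrableB mD (fint _) si).
  - exact: (integrableZl mD `|eta - I| (sint n)).
  move=> t Dt; rewrite -dotBl (le_trans (ler_norm _))// mulrC.
  exact: cauchy_schwarz.
rewrite /bochner_integral; case: xgetP => [v _ [s sf sv]|].
  exact: (@cvg_unique _ (@norm_hausdorff _ V) _ _ _ _ sv (lims _ sf)).
by move=> /(_ eta) []; exists s0 => //; exact: lims.
Qed.
End Bochner.
End Hilbert.

(** * Boundedness of an everywhere finite integral seminorm *)

Section Bound.
Context (R : realType) (d : measure_display) (T : measurableType d).
Context (mu : {measure set T -> \bar R}) (D : set T).
Context (V : completeNormedModType R).
Context (Phi : V -> T -> R).
Hypothesis mD : measurable D.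
Hypothesis PhiP : forall c f g t, D t ->
  Phi (f + c *: g) t = Phi f t + c * Phi g t.
Hypothesis Phi_cvg : forall t (u : nat -> V) f, D t -> u n @[n --> \oo] --> f ->
  Phi (u n) t @[n --> \oo] --> Phi f t.
Hypothesis Phi_int : forall f, mu.-integrable D (EFin \o Phi f).

Let p f := \int[mu]_(t in D) `|Phi f t|.

Let absint f : mu.-integrable D (EFin \o (fun t => `|Phi f t|)).
Proof. exact: integrable_abse (Phi_int f). Qed.

Let pE f : (p f)%:E = (\int[mu]_(t in D) `|Phi f t|%:E)%E.
Proof. by rewrite /p /Rintegral fineK//; exact: integrable_fin_num (absint f). Qed.

Let pD c f g : p (f + c *: g) <= p f + `|c| * p g.
Proof.
have Zg : mu.-integrable D (EFin \o (fun t => `|c| * `|Phi g t|)).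
  exact: (integrableZl mD `|c| (absint g)).
rewrite /p -RintegralZl// -RintegralD//.
apply: le_Rintegral => //.
  exact: (integrableD mD (absint f) Zg).
by move=> t Dt; rewrite PhiP// (le_trans (ler_normD _ _))// normrM.
Qed.

Let pZ c g : p (c *: g) = `|c| * p g.
Proof.
have P0 t : D t -> Phi 0 t = 0.
  by move=> Dt; have := PhiP (-1) 0 0 Dt; rewrite scaler0 addr0 mulN1r subrr.
rewrite /p -RintegralZl//; apply: eq_Rintegral => t /set_mem Dt.
by rewrite -[c *: g]add0r PhiP// P0// add0r normrM.
Qed.

(* Lower semicontinuity of [p], by Fatou's lemma along a convergent sequence. *)
Let p_closed (c : R) : closed [set f | p f <= c].
Proof.
move=> f cf.
have /choice[u up] : forall n, exists g, `|f - g| < n.+1%:R^-1 /\ p g <= c.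
  move=> n.
  have n0 : 0 < (n.+1%:R^-1 : R) by rewrite invr_gt0.
  have [g [/= pg]] := cf _ (nbhsx_ballx f _ n0).
  by rewrite -ball_normE => fg; exists g.
have uf : u n @[n --> \oo] --> f.
  apply/cvgrPdist_lt => e e0; near=> n.
  have [+ _] := up n; move=> /lt_trans; apply.
  by near: n; exact: near_infty_natSinv_lt (PosNum e0).
rewrite /= -lee_fin pE.
pose F n t : \bar R := `|Phi (u n) t|%:E.
have mF n := (measurable_int mu (absint (u n))).
have F0 n t : D t -> (0 <= F n t)%E by rewrite /F lee_fin.
have := fatou mu mD mF F0.
rewrite (eq_integral (fun t => `|Phi f t|%:E)); last first.
  move=> t /set_mem Dt.
  have h : F n t @[n --> \oo] --> `|Phi f t|%:E.
    by apply: cvg_EFin; [exact: nearW|apply: cvg_norm; exact: Phi_cvg].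
  rewrite is_cvg_limn_einfE; last by apply/cvg_ex; exists (`|Phi f t|%:E).
  exact/cvg_lim.
move=> /le_trans; apply.
rewrite limn_einf_lim; apply: lime_le; first exact: is_cvg_einfs.
apply: nearW => n; apply: (@le_trans _ _ (\int[mu]_(t in D) F n t)%E).
  by apply: ereal_inf_lbound; exists n => /=.
by rewrite -pE lee_fin; have [] := up n.
Unshelve. all: end_near. Qed.

(** The sublevel sets of the seminorm are closed and cover the space, so by
    Baire's theorem one of them contains a ball. *)
Lemma L1_seminorm_bounded : exists2 C, 0 <= C &
  forall f, \int[mu]_(t in D) `|Phi f t| <= C * `|f|.
Proof.
suff [C C0 pC] : exists2 C, 0 <= C & forall f, p f <= C * `|f| by exists C.
have [n /existsNP[U /not_implyP[[f0 Uf0] /not_implyP[Uop /nonemptyPn U0]]]] :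
    exists n, ~ dense [set f | n%:R < p f].
  apply/existsNP => dn.
  have : dense (\bigcap_n [set f | n%:R < p f]).
    apply: Baire => n; split; last exact: dn.
    rewrite (_ : mkset _ = ~` [set f | p f <= n%:R]); last first.
      by apply/seteqP; split=> f /=; rewrite ltNge => /negP.
    by rewrite openC; exact: p_closed.
  move=> /(_ setT (ex_intro _ 0 I) openT)[f [_ /(_ (Num.truncn (p f)).+1 I)]] /=.
  by rewrite ltNge ltW// truncnS_gt.
have Un f : U f -> p f <= n%:R.
  move=> Uf; rewrite leNgt; apply/negP => h.
  by have : (U `&` [set f | n%:R < p f]) f by []; rewrite U0.
have [r r0 rU] : exists2 r : R, 0 < r & ball f0 r `<=` U.
  by have /nbhs_ballP := open_nbhs_nbhs (conj Uop Uf0).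
exists (4 * n%:R / r); first by rewrite divr_ge0 ?(ltW r0)// mulr_ge0.
move=> h; have [->|h0] := eqVneq h 0.
  by rewrite -{1}(scale0r (0 : V)) pZ !normr0 mul0r mulr0.
have h0' : 0 < `|h| by rewrite normr_gt0.
pose t := r / (2 * `|h|).
have t0 : 0 < t by rewrite divr_gt0// mulr_gt0.
have f0n := Un _ Uf0.
have ftn : p (f0 + t *: h) <= n%:R.
  apply/Un/rU; rewrite -ball_normE /= opprD addrA subrr add0r normrN normrZ.
  rewrite gtr0_norm// /t invfM mulrA mulfVK ?gt_eqF//.
  by rewrite ltr_pdivrMr// ltr_pMr// ltr1n.
(* [t *: h] is the difference of two points of the ball around [f0]. *)
have := pD (-1) (f0 + t *: h) f0.
rewrite scaleN1r addrAC subrr add0r pZ gtr0_norm// normrN1 mul1r => th.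
have : t * p h <= 2 * n%:R by rewrite (le_trans th)// mulr2n mulrDl !mul1r lerD.
rewrite mulrC -ler_pdivlMr// => /le_trans; apply.
rewrite le_eqVlt; apply/orP; left; apply/eqP.
by rewrite /t; field; rewrite !gt_eqF.
Qed.
End Bound.

(** * Operators defined by a feature map *)

(** Equal Gram matrices mean that a combination of the [u x] and the combination
    of the [v x] with the same coefficients have the same norm.  So the
    functional that sends a combination of the [v x] to the inner product of [f]
    with the corresponding combination of the [u x] is well defined and bounded
    by [`|f|], and [riesz_subspace] applies to its graph. *)
Lemma gram_transfer (R : realType) (U V : completeNormedModType R)
    (a : {dot U for idfun}) (b : {dot V for idfun})
    (Ua : forall f : U, `|f| = Num.sqrt (a f f))
    (Vb : forall f : V, `|f| = Num.sqrt (b f f))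
    (X : Type) (u : X -> U) (v : X -> V) :
  (forall x y, a (u x) (u y) = b (v x) (v y)) ->
  forall f, exists2 g, (forall x, b g (v x) = a f (u x)) & `|g| <= `|f|.
Proof.
move=> uv f.
pose lc (W : lmodType R) (w : X -> W) (l : seq (R * X)) :=
  \sum_(q <- l) q.1 *: w q.2.
have lcD (W : lmodType R) (w : X -> W) l l' c :
    lc _ w (l ++ [seq (c * q.1, q.2) | q <- l']) = lc _ w l + c *: lc _ w l'.
  rewrite /lc big_cat big_map scaler_sumr; congr (_ + _).
  by apply: eq_bigr => q _; rewrite scalerA.
have lc_norm l : `|lc _ u l| = `|lc _ v l|.
  rewrite Ua Vb; congr Num.sqrt; rewrite /lc !dot_suml.
  apply: eq_bigr => q _; congr (_ * _).
  rewrite dotC (dotC b) !dot_suml.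
  by apply: eq_bigr => r _; rewrite uv.
have [|w a1 w' a1' c [l [-> ->]] [l' [-> ->]]|w a1 [l [-> ->]]|g gv gf] :=
  @riesz_subspace _ V b Vb
    (fun w z => exists l, w = lc _ v l /\ z = a f (lc _ u l)) `|f| (normr_ge0 f).
- by exists [::]; rewrite /lc !big_nil dot0r.
- by exists (l ++ [seq (c * q.1, q.2) | q <- l']); rewrite !lcD dotDr dotZr.
- by rewrite -lc_norm; exact: cauchy_schwarz.
exists g => // x; apply: gv; exists [:: (1, x)].
by rewrite /lc !big_seq1 !scale1r.
Qed.

Lemma exists_linear (R : pzRingType) (U V : lmodType R) (f : U -> V) :
  linear f -> exists F : {linear U -> V}, F =1 f.
Proof.
move=> lf.
pose F : {linear U -> V} := HB.pack f (GRing.isLinear.Build R U V *:%R f lf).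
by exists F.
Qed.

Section FeatureMap.
Context (R : realType) (E E' : Type) (K : E -> E -> R) (K' : E' -> E' -> R).
Context (H : rkhs K) (H' : rkhs K') (u : E' -> H).
Hypothesis uK : forall x y, ip (u x) (u y) = K' x y.

Lemma ip_gen x y : ip (gen x : H') (gen y) = K' x y.
Proof. by rewrite -reproducing ev_gen -uK dotC uK. Qed.

(** The generators separate points because [ev] is injective; this takes the
    place of the density of their span. *)
Lemma gen_sep (g h : H') : (forall x, ip g (gen x) = ip h (gen x)) -> g = h.
Proof.
by move=> gh; apply: ev_inj; apply/funext => x; rewrite !reproducing.
Qed.

(** The function [x |-> ip f (u x)] belongs to the RKHS of the Gram kernel of
    [u], and the map sending [f] to it is a coisometry whose adjoint maps the
    generators to the features. *)
Lemma feature_operator : exists (P : {linear H -> H'}) (Pa : {linear H' -> H}),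
  [/\ is_adjoint P Pa, forall x, Pa (gen x) = u x & forall g, P (Pa g) = g].
Proof.
have /choice[P0 P0P] : forall f : H, exists g : H',
    (forall x, ip g (gen x) = ip f (u x)) /\ `|g| <= `|f|.
  move=> f.
  have uv x y : ip (u x) (u y) = ip (gen x : H') (gen y) by rewrite ip_gen uK.
  by have [g] := gram_transfer (@normE _ _ _ H) (@normE _ _ _ H') uv f; exists g.
have /exists_linear[P PE] : linear P0.
  move=> c f g; apply: gen_sep => x.
  by rewrite dotDl dotZl !(proj1 (P0P _)) dotDl dotZl.
have P_gen f x : ip (P f) (gen x) = ip f (u x) by rewrite PE (proj1 (P0P _)).
have P_le f : `|P f| <= `|f| by rewrite PE (proj2 (P0P _)).
have /choice[Q0 Q0P] : forall g : H', exists h : H, forall f, ip f h = ip (P f) g.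
  move=> g; apply: (@riesz_representation _ H _ (@normE _ _ _ H) _ `|g|) => //.
    by move=> c f h; rewrite linearD linearZ dotDl dotZl.
  move=> f; apply: le_trans (cauchy_schwarz (@normE _ _ _ H') _ _) _.
  by rewrite mulrC ler_wpM2l.
have /exists_linear[Pa PaE] : linear Q0.
  move=> c g h; apply: (dot_sepl (@normE _ _ _ H)) => f.
  rewrite dotC Q0P dotDr dotZr dotDl dotZl.
  by rewrite (dotC _ (Q0 g)) (dotC _ (Q0 h)) !Q0P.
have adj : is_adjoint P Pa by move=> f g; rewrite PaE Q0P.
have Pa_gen x : Pa (gen x) = u x.
  apply: (dot_sepl (@normE _ _ _ H)) => f.
  by rewrite dotC -adj P_gen dotC.
have PPa_gen x : P (Pa (gen x)) = gen x.
  by apply: gen_sep => y; rewrite P_gen Pa_gen uK ip_gen.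
exists P, Pa; split => // g.
(* [P \o Pa] is self-adjoint and fixes the generators. *)
by apply: gen_sep => x; rewrite adj dotC -adj PPa_gen dotC.
Qed.
End FeatureMap.

Section Coisometry.
Context (R : realType) (E E' : Type) (K : E -> E -> R) (K' : E' -> E' -> R).
Context (H : rkhs K) (H' : rkhs K').
Context (P : {linear H -> H'}) (Pa : {linear H' -> H}).
Hypotheses (adj : is_adjoint P Pa) (PPa : forall g, P (Pa g) = g).

Lemma adjoint_isometry g : `|Pa g| = `|g|.
Proof. by rewrite !normE -adj PPa. Qed.

Lemma coisometry_contractive f : `|P f| <= `|f|.
Proof.
have [->|Pf0] := eqVneq (P f) 0; first by rewrite normr0.
rewrite -(@ler_pM2r _ `|P f|) ?normr_gt0//.
rewrite -expr2 -(dot_norm (@normE _ _ _ H')) adj -[X in _ * X]adjoint_isometry.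
by apply: le_trans (ler_norm _) _; exact: (cauchy_schwarz (@normE _ _ _ H)).
Qed.

Lemma range_adjoint_fix f : range Pa f <-> f = Pa (P f).
Proof. by split=> [[g _ <-]|->]; [rewrite PPa|exists (P f)]. Qed.

Lemma null_space_residual f : null_space P (f - Pa (P f)).
Proof. by rewrite /null_space/= linearB PPa subrr. Qed.

Lemma range_adjoint_null f h : range Pa f -> null_space P h -> ip f h = 0.
Proof.
by move=> [g _ <-] Ph; rewrite dotC -adj (Ph : P h = 0) dot0l.
Qed.
End Coisometry.

Lemma gram_is_kernel (R : realType) (E E' : Type) (K : E -> E -> R)
    (K' : E' -> E' -> R) (H : rkhs K) (u : E' -> H) :
  (forall x y, ip (u x) (u y) = K' x y) -> is_kernel K'.
Proof.
move=> uK; split=> [x y|p x c]; first by rewrite -!uK dotC.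
pose w := \sum_(i < p) c i *: u (x i).
rewrite (_ : \sum_(i < p) _ = ip w w); first exact: dot_ge0.
rewrite {1}/w dot_suml; apply: eq_bigr => i _.
rewrite dotC dot_suml mulr_sumr; apply: eq_bigr => j _.
by rewrite -uK mulrA dotC.
Qed.

Lemma continuous_linear_norm_le (R : realType) (U V : normedModType R)
    (T : {linear U -> V}) : continuous T ->
  exists2 C, 0 <= C & forall f, `|T f| <= C * `|f|.
Proof.
move=> cT; have /linear_boundedP/pinfty_ex_gt0[C C0 TC] :=
  continuous_linear_bounded 0 (cT 0).
by exists C => //; exact: ltW.
Qed.

(** For fixed [h], Riesz turns [g |-> ip (S g - T g) h] into the inner product
    with a vector that is orthogonal to all generators, hence zero. *)
Lemma eq_continuous_gen (R : realType) (E E' : Type) (K : E -> E -> R)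
    (K' : E' -> E' -> R) (H : rkhs K) (H' : rkhs K') (S T : {linear H' -> H}) :
  continuous S -> continuous T -> (forall x, S (gen x) = T (gen x)) -> S =1 T.
Proof.
move=> /continuous_linear_norm_le[C C0 SC].
move=> /continuous_linear_norm_le[D D0 TD] ST g.
apply: (dot_sepl (@normE _ _ _ H)) => h.
have [|c f k|f|w wE] := @riesz_representation _ H' _ (@normE _ _ _ H')
    (fun f => ip (S f - T f) h) ((C + D) * `|h|).
- by rewrite mulr_ge0// addr_ge0.
- rewrite -dotZl -dotDl; congr (ip _ h).
  by rewrite !linearD !linearZ/= addrACA.
- apply: le_trans (cauchy_schwarz (@normE _ _ _ H) _ _) _.
  rewrite mulrAC ler_wpM2r// mulrDl (le_trans (ler_normB _ _))//.
  by rewrite lerD.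
suff w0 : w = 0.
  by apply/eqP; rewrite -subr_eq0 -dotBl -wE w0 dot0r.
apply: gen_sep => x.
by rewrite dotC wE ST subrr !dot0l.
Qed.

(** * The X-ray transform on an RKHS *)

Section XRayRepresenter.
Context (R : realType) (m : nat) (K : uball R (m + 1) -> uball R (m + 1) -> R).
Context (Q : 'M[R]_(m + 1)) (H : rkhs K).
Hypothesis hP : forall f : H, xray_exists Q (ev f).

Lemma measurable_chord (x : uball R m) :
  measurable (chord x : set (measurableTypeR R)).
Proof. exact: measurable_itv. Qed.

(** Point evaluations are continuous on an RKHS, so [L1_seminorm_bounded] applies
    to the restrictions of the functions of [H] to the chord. *)
Lemma xray_representer (x : uball R m) :
  exists eta : H, forall f, ip f eta = xray Q (ev f) x.
Proof.
have mx := measurable_chord x.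
pose Phi (f : H) t := ev f (ray Q x t).
have PhiP c (f g : H) t : chord x t -> Phi (f + c *: g) t = Phi f t + c * Phi g t.
  by move=> _; rewrite /Phi linearD linearZ.
have Phi_cvg t (v : nat -> H) (f : H) : chord x t -> v n @[n --> \oo] --> f ->
    Phi (v n) t @[n --> \oo] --> Phi f t.
  move=> _ vf; rewrite /Phi reproducing; under eq_fun do rewrite reproducing.
  exact: (dot_cvgl (@normE _ _ _ H)).
have Phi_int f : lebesgue_measure.-integrable (chord x) (EFin \o Phi f).
  exact: hP.
have [C C0 PhiC] := L1_seminorm_bounded mx PhiP Phi_cvg Phi_int.
apply: (@riesz_representation _ H _ (@normE _ _ _ H) _ C C0) => [c f g|f].
  rewrite -RintegralZl//; last exact: Phi_int.
  rewrite /xray -RintegralD//; last 2 first.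
    exact: Phi_int.
    exact: (integrableZl mx c (Phi_int g)).
  by apply: eq_Rintegral => t /set_mem xt; exact: PhiP.
apply: le_trans (PhiC f).
by apply: le_normr_Rintegral => //; exact: Phi_int.
Qed.

(** The inner integral of the induced kernel is the value of [eta x] at a point of
    the second chord, and the outer one is the transform of [eta x]. *)
Lemma induced_kernel_gram (eta : uball R m -> H) :
  (forall x f, ip f (eta x) = xray Q (ev f) x) ->
  forall x y, ip (eta x) (eta y) = induced_kernel Q K x y.
Proof.
move=> etaP x y; rewrite etaP; apply: eq_Rintegral => z2 _.
rewrite reproducing dotC etaP; apply: eq_Rintegral => z1 _.
by rewrite ev_gen.
Qed.
End XRayRepresenter.

Theorem theorem3p4 (R : realType) (m : nat) (hn : (2 <= m + 1)%N)
    (K : uball R (m + 1) -> uball R (m + 1) -> R) (hK : is_kernel K)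
    (Q : 'M[R]_(m + 1)) (hQ : SO Q) (H : rkhs K)
    (hP : forall f : H, xray_exists Q (ev f))
    (hKt : induced_kernel_exists Q K) :
  is_kernel (induced_kernel Q K) /\
  forall Ht : rkhs (induced_kernel Q K),
  exists P : {linear H -> Ht},
  [/\ forall f : H, ev (P f) = xray Q (ev f),
      forall f : H, `|P f| <= `|f|,
      forall g : Ht, exists f : H, P f = g &
  exists Pa : {linear Ht -> H},
  [/\ is_adjoint P Pa,
      forall g : Ht, `|Pa g| = `|g|,
      (* action of the adjoint on the generators *)
      (forall x : uball R m,
         bochner_integrable lebesgue_measure (chord x)
           (fun z : R => gen (ray Q x z) : H) ->
         Pa (gen x) = bochner_integral lebesgue_measure (chord x)
           (fun z : R => gen (ray Q x z))) /\
      (forall (x : uball R m) (z : uball R (m + 1)),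
         [/\ ev (Pa (gen x)) z = ip (Pa (gen x)) (gen z),
             ip (Pa (gen x)) (gen z) =
               \int[lebesgue_measure]_(t in chord x) K z (ray Q x t) &
             \int[lebesgue_measure]_(t in chord x) K z (ray Q x t) =
               xray Q (ev (gen z : H)) x]),
      (* either formula determines the adjoint *)
      forall T : {linear Ht -> H}, continuous T ->
        ((forall x : uball R m,
            bochner_integrable lebesgue_measure (chord x)
              (fun z : R => gen (ray Q x z) : H) /\
            T (gen x) = bochner_integral lebesgue_measure (chord x)
              (fun z : R => gen (ray Q x z))) \/
         (forall (x : uball R m) (z : uball R (m + 1)),
            ev (T (gen x)) z =
              \int[lebesgue_measure]_(t in chord x) K z (ray Q x t))) ->
        T =1 Pa &
  [/\ (* (1) *)
      forall g : Ht, P (Pa g) = g,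
      (* (2) *)
      range Pa = orthogonal_compl (null_space P) /\
      orthogonal_compl (range Pa) = null_space P,
      (* (3) *)
      forall f : H,
        [/\ range Pa (Pa (P f)),
            null_space P (f - Pa (P f)),
            f = Pa (P f) + (f - Pa (P f)),
            forall a b : H, range Pa a -> null_space P b -> f = a + b ->
              a = Pa (P f) /\ b = f - Pa (P f) &
            range Pa f <-> f = Pa (P f)] &
      (* (4) *)
      forall g : Ht,
        [/\ [set f : H | g = P f] = [set Pa g + h | h in null_space P],
            `|g| = `|Pa g|,
            [set `|f| | f in [set f : H | g = P f]] `|Pa g| &
            lbound [set `|f| | f in [set f : H | g = P f]] `|Pa g|]]]].
Proof.
have /choice[eta etaP] := xray_representer hP.
have etaK := induced_kernel_gram etaP.
split; first exact: gram_is_kernel etaK.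
move=> Ht.
have [P [Pa [adj Pa_gen PPa]]] := feature_operator Ht etaK.
have Pa_norm := adjoint_isometry adj PPa.
have P_le := coisometry_contractive adj PPa.
exists P; split => //.
- move=> f; apply/funext => x.
  by rewrite reproducing adj Pa_gen etaP.
- by move=> g; exists (Pa g).
have evPa x z : ev (Pa (gen x)) z = xray Q (ev (gen z : H)) x.
  by rewrite reproducing Pa_gen dotC etaP.
have xray_gen x z : xray Q (ev (gen z : H)) x =
    \int[lebesgue_measure]_(t in chord x) K z (ray Q x t).
  by apply: eq_Rintegral => t _; rewrite ev_gen (proj1 hK).
have Pa_bochner x : bochner_integrable lebesgue_measure (chord x)
      (fun t => gen (ray Q x t) : H) ->
    Pa (gen x) = bochner_integral lebesgue_measure (chord x)
      (fun t => gen (ray Q x t)).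
  move=> bx; rewrite Pa_gen; apply/esym.
  have evE g : (fun t => ip (gen (ray Q x t)) g) = (fun t => ev g (ray Q x t)).
    by apply/funext => t; rewrite reproducing dotC.
  apply: (bochner_integral_weak (@normE _ _ _ H)) => // [|g|g].
  - exact: measurable_chord.
  - have := hP g x.
    by rewrite -[X in _.-integrable _ X]/(EFin \o (fun t => ev g (ray Q x t))) -evE.
  - by rewrite dotC etaP evE.
have Pa_cont : continuous Pa.
  apply: bounded_linear_continuous; apply/linear_boundedP.
  by near=> r => g; rewrite Pa_norm ler_peMl.
exists Pa; split => //.
- split => // x z; split.
  + by rewrite reproducing.
  + by rewrite -reproducing evPa xray_gen.
  + by rewrite xray_gen.
- move=> T cT TE; apply: eq_continuous_gen => // x; case: TE => TE.
    by have [bx ->] := TE x; rewrite Pa_bochner.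
  by apply: ev_inj; apply/funext => z; rewrite TE evPa xray_gen.
have range_fix := range_adjoint_fix PPa.
have resid := null_space_residual PPa.
have orth := range_adjoint_null adj.
split => //.
- split; apply/seteqP; split => f.
  + by move=> rf h Ph; exact: orth.
  + move=> fo; apply/range_fix/eqP; rewrite -subr_eq0; apply/eqP.
    apply: (dot_eq0 (@normE _ _ _ H)).
    have PaPf : range Pa (Pa (P f)) by exists (P f).
    by rewrite dotBl (fo _ (resid f)) (orth _ _ PaPf (resid f)) subr0.
  + move=> fo; apply: (dot_eq0 (@normE _ _ _ Ht)).
    by rewrite adj fo//; exists (P f).
  + by move=> Pf h rh; rewrite dotC orth.
- move=> f; split => //.
  + by rewrite addrC subrK.
  + move=> a c /range_fix ra Pc ->.
    by rewrite linearD (Pc : P c = 0) addr0 -ra addrAC subrr add0r.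
- move=> g; split.
  + apply/seteqP; split=> [f /= gPf|_ [h Ph <-] /=].
      exists (f - Pa g); last by rewrite addrC subrK.
      by rewrite gPf; exact: resid.
    by rewrite linearD PPa (Ph : P h = 0) addr0.
  + by rewrite Pa_norm.
  + by exists (Pa g) => /=.
  + by move=> _ [f /= -> <-]; rewrite Pa_norm.
Unshelve. all: end_near.
Qed.
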